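(* Let $G$ be a locally finite weakly connected digraph and let $s,t\in V(G)\cup\Omega(G)$ with $s\neq t$. Then every directed topological $s$--$t$ walk in $|G|$ contains a directed $s$--$t$ arc.
   Context: Digraphs may be infinite and may have parallel edges but no loops. A digraph is weakly connected (locally finite) if its underlying undirected multigraph is connected (has only finite degrees). Ends: a ray is a one-way infinite undirected path; two rays in a multigraph are equivalent if they cannot be separated by finitely many vertices, and the equivalence classes are the ends. The ends of $G$, forming the set $\Omega(G)$, are those of its underlying multigraph $H$. The space $|G|$: for a locally finite weakly connected digraph $G$ with underlying multigraph $H$, $|G|:=|H|$ is the Freudenthal compactification of the $1$-complex of $H$. Its points are the points of the $1$-complex (each edge being a copy of $[0,1]$ joining its endvertices) together with the ends. Points of the $1$-complex have their usual basic neighbourhoods; basic open neighbourhoods of an end $\omega$ are given by finite sets $S\subseteq V$ and consist of the component $C$ of $H-S$ in which $\omega$ has a ray, all ends with a ray in $C$, and, for every edge between $C$ and $S$, a half-open partial edge at its endvertex in $C$ (of length $\varepsilon$ for some $\varepsilon\in(0,1]$). $\mathring{e}$ denotes the set of inner points of an edge $e$, $\mathring{E}$ the union of all $\mathring{e}$, $e\in E(G)$, and $\overline{\{e\}}$ the closed edge $e$ (including its endvertices) in $|G|$. Topological walks: for $W\subseteq|G|$ and a linear order $<_W$ on $\mathring{E}\cap W$, the pair $(W,<_W)$ is a topological walk if there is a continuous map $\sigma:[0,1]\to|G|$ (a witness) such that $W$ is the image of $\sigma$, each $p\in\mathring{E}\cap W$ has precisely one preimage under $\sigma$, and for $p,q\in\mathring{E}\cap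 W$ we have $p<_W q$ if and only if $\sigma^{-1}(p)<\sigma^{-1}(q)$. Each edge $e=uv$ (tail $u$, head $v$) carries the linear order $<_e$ on $\overline{\{e\}}$ induced by any homeomorphism $\varphi_e:[0,1]\to\overline{\{e\}}$ with $\varphi_e(0)=u$, $\varphi_e(1)=v$. A topological walk $(W,<_W)$ is directed if $<_W$ and $<_e$ agree on $\mathring{e}$ for every edge $e\in E(G)$ with $\mathring{e}\cap W\neq\emptyset$. A directed topological $s$--$t$ walk (for $s\ne t$) is one whose witnesses $\sigma$ satisfy $\sigma(0)=s$ and $\sigma(1)=t$. An arc in $|G|$ is the image of a homeomorphism from $[0,1]$ onto a subspace of $|G|$. A directed $s$--$t$ arc is an arc that, with a suitable linear order, is a directed topological $s$--$t$ walk. A walk $(W,<_W)$ contains an arc $A$ if $A\subseteq W$. *)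

(* Defs.v *)
From HB Require Import structures.
From mathcomp Require Import all_boot all_order all_algebra.
From mathcomp Require Import all_classical all_reals all_analysis.
Set Implicit Arguments.
Unset Strict Implicit.
Unset Printing Implicit Defensive.
Import Order.TTheory GRing.Theory Num.Theory.
Import numFieldNormedType.Exports.
Local Open Scope classical_set_scope.
Local Open Scope ring_scope.

Record digraph := Digraph {
  vertex : Type;
  edge : Type;
  etail : edge -> vertex;
  ehead : edge -> vertex;
  no_loop : forall e, etail e <> ehead e }.

(* e joins u and v in the underlying undirected multigraph H. *)
Definition joins (G : digraph) (e : edge G) (u v : vertex G) : Prop :=
  (etail e = u /\ ehead e = v) \/ (etail e = v /\ ehead e = u).

Definition locally_finite (G : digraph) : Prop :=
  forall v : vertex G, finite_set [set e : edge G | etail e = v \/ ehead e = v].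

(* There is a u--v path in H - S. *)
Inductive connected_off (G : digraph) (S : set (vertex G)) (u : vertex G) :
    vertex G -> Prop :=
| connected_off_refl : ~ S u -> connected_off S u u
| connected_off_step v w e :
    connected_off S u v -> joins e v w -> ~ S w -> connected_off S u w.

Definition weakly_connected (G : digraph) : Prop :=
  forall u v : vertex G, connected_off set0 u v.

Definition is_component (G : digraph) (S C : set (vertex G)) : Prop :=
  exists2 u, ~ S u & C = [set v | connected_off S u v].

Record ray (G : digraph) := Ray {
  ray_vertex : nat -> vertex G;
  ray_edge : nat -> edge G;
  ray_inj : injective ray_vertex;
  ray_joins : forall n, joins (ray_edge n) (ray_vertex n) (ray_vertex n.+1) }.

(* S meets every path from r to r'; such a path may be trivial, and its
   endvertices count. *)
Definition separates (G : digraph) (S : set (vertex G)) (r r' : ray G) : Prop :=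
  forall m n, ~ connected_off S (ray_vertex r m) (ray_vertex r' n).

Definition ray_equiv (G : digraph) (r r' : ray G) : Prop :=
  ~ exists2 S, finite_set S & separates S r r'.

Definition is_end (G : digraph) (w : set (ray G)) : Prop :=
  exists r, w = [set r' | ray_equiv r r'].

Definition graph_end (G : digraph) : Type := {w : set (ray G) | is_end w}.

Definition has_ray_in (G : digraph) (w : graph_end G) (C : set (vertex G)) :=
  exists2 r, sval w r & forall n, C (ray_vertex r n).

(* The underlying set of |G|. The inner points of an edge e are indexed by
   the reals strictly between 0 and 1, running from the tail to the head. *)
Inductive freudenthal (R : realType) (G : digraph) : Type :=
| VertexPt of vertex G
| InnerPt of edge G & {x : R | 0 < x < 1}
| EndPt of graph_end G.
Arguments VertexPt {R G}.
Arguments InnerPt {R G}.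
Arguments EndPt {R G}.

HB.instance Definition _ (R : realType) (G : digraph) :=
  gen_eqMixin (freudenthal R G).
HB.instance Definition _ (R : realType) (G : digraph) :=
  gen_choiceMixin (freudenthal R G).

Definition vertex_nbhd (R : realType) (G : digraph) (v : vertex G) (eps : R) :
    set (freudenthal R G) :=
  fun p => match p with
  | VertexPt u => u = v
  | InnerPt e x =>
      (etail e = v /\ sval x < eps) \/ (ehead e = v /\ 1 - sval x < eps)
  | EndPt _ => False
  end.

Definition inner_nbhd (R : realType) (G : digraph) (e : edge G) (a b : R) :
    set (freudenthal R G) :=
  fun p => match p with
  | VertexPt _ => False
  | InnerPt e' x => e' = e /\ a < sval x < b
  | EndPt _ => False
  end.

Definition end_nbhd (R : realType) (G : digraph) (S C : set (vertex G))
    (eps : R) : set (freudenthal R G) :=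
  fun p => match p with
  | VertexPt u => C u
  | InnerPt e x =>
      [\/ C (etail e) /\ C (ehead e),
          [/\ C (etail e), S (ehead e) & sval x < eps] |
          [/\ S (etail e), C (ehead e) & 1 - sval x < eps]]
  | EndPt w => has_ray_in w C
  end.

Definition basic_open (R : realType) (G : digraph) :
    set (set (freudenthal R G)) :=
  [set U |
    [\/ exists v, exists2 eps, 0 < eps <= 1 & U = vertex_nbhd v eps,
        exists e a b, U = inner_nbhd e a b |
        exists w S C eps,
          [/\ finite_set S, is_component S C, has_ray_in w C, 0 < eps <= 1 &
              U = end_nbhd S C eps]]].

HB.instance Definition _ (R : realType) (G : digraph) :=
  @isSubBaseTopological.Build (freudenthal R G)
    (set (freudenthal R G)) (@basic_open R G) id.

Definition edge_interior (R : realType) (G : digraph) (e : edge G) :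
    set (freudenthal R G) :=
  [set p | exists x, p = InnerPt e x].

Definition edges_interior (R : realType) (G : digraph) :
    set (freudenthal R G) :=
  \bigcup_e edge_interior e.
Arguments edges_interior {R G}.

Definition closed_edge (R : realType) (G : digraph) (e : edge G) :
    set (freudenthal R G) :=
  edge_interior e `|` [set VertexPt (etail e); VertexPt (ehead e)].

Definition vertex_or_end (R : realType) (G : digraph) :
    set (freudenthal R G) :=
  range VertexPt `|` range EndPt.
Arguments vertex_or_end {R G}.

(* f, restricted to [0, 1], is a homeomorphism onto the subspace A of T. *)
Definition homeo01 (R : realType) (T : topologicalType) (f : R -> T)
    (A : set T) : Prop :=
  [/\ {within `[0, 1], continuous f}, f @` `[0, 1] = A &
      exists2 g : T -> R, {within A, continuous g} &
        forall x, `[0, 1]%classic x -> g (f x) = x].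

(* All such homeomorphisms phi induce the same order. *)
Definition edge_lt (R : realType) (G : digraph) (e : edge G)
    (p q : freudenthal R G) : Prop :=
  exists phi : R -> freudenthal R G,
    [/\ homeo01 phi (closed_edge e),
        phi 0 = VertexPt (etail e), phi 1 = VertexPt (ehead e) &
        exists x y, [/\ 0 <= x, x < y, y <= 1, phi x = p & phi y = q]].

Definition strict_linear_order_on (T : Type) (D : set T)
    (lt : T -> T -> Prop) : Prop :=
  [/\ forall p, D p -> ~ lt p p,
      forall p q r, D p -> D q -> D r -> lt p q -> lt q r -> lt p r &
      forall p q, D p -> D q -> [\/ lt p q, p = q | lt q p]].

(* A linear order on a set of points is a relation on |G| whose values off
   that set are irrelevant, and a map from [0, 1] is a function on R whose
   values off [0, 1] are irrelevant. *)
Definition witness (R : realType) (G : digraph) (W : set (freudenthal R G))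
    (ltW : freudenthal R G -> freudenthal R G -> Prop)
    (sigma : R -> freudenthal R G) : Prop :=
  [/\ {within `[0, 1], continuous sigma},
      sigma @` `[0, 1] = W,
      forall p, (edges_interior `&` W) p ->
        exists! x, `[0, 1]%classic x /\ sigma x = p &
      forall x y, `[0, 1]%classic x -> `[0, 1]%classic y ->
        edges_interior (sigma x) -> edges_interior (sigma y) ->
        (ltW (sigma x) (sigma y) <-> x < y)].

Definition topological_walk (R : realType) (G : digraph)
    (W : set (freudenthal R G))
    (ltW : freudenthal R G -> freudenthal R G -> Prop) : Prop :=
  strict_linear_order_on (edges_interior `&` W) ltW /\
  exists sigma, witness W ltW sigma.

Definition directed (R : realType) (G : digraph) (W : set (freudenthal R G))
    (ltW : freudenthal R G -> freudenthal R G -> Prop) : Prop :=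
  forall e : edge G, edge_interior e `&` W !=set0 ->
    forall p q, (edge_interior e `&` W) p -> (edge_interior e `&` W) q ->
      (ltW p q <-> edge_lt e p q).

Definition directed_topological_walk (R : realType) (G : digraph)
    (s t : freudenthal R G) (W : set (freudenthal R G))
    (ltW : freudenthal R G -> freudenthal R G -> Prop) : Prop :=
  [/\ topological_walk W ltW, directed W ltW &
      forall sigma, witness W ltW sigma -> sigma 0 = s /\ sigma 1 = t].

Definition is_arc (R : realType) (T : topologicalType) (A : set T) : Prop :=
  exists f : R -> T, homeo01 f A.

Definition directed_arc (R : realType) (G : digraph)
    (s t : freudenthal R G) (A : set (freudenthal R G)) : Prop :=
  is_arc R A /\ exists ltA, directed_topological_walk s t A ltA.

(* Main.v *)
Require Import Defs.
From mathcomp Require Import all_boot all_order all_algebra finmap lra.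
From mathcomp Require Import all_classical all_reals all_analysis.
From mathcomp Require Import measurable_realfun.
Set Implicit Arguments.
Unset Strict Implicit.
Unset Printing Implicit Defensive.
Import Order.TTheory GRing.Theory Num.Theory.
Import numFieldNormedType.Exports.
Local Open Scope classical_set_scope.
Local Open Scope ring_scope.

(* Erase loops from a witness sigma of the walk. By Zorn's lemma there is a
   minimal closed set K in [0, 1] containing 0 and 1 such that sigma takes the
   same value at both ends of every gap of K; by minimality, sigma identifies
   two points of K only if they are the ends of a gap. Points of K with image
   inside an edge have a neighbourhood contained in K, since they have no other
   preimage; and such points lie between any two points of K with distinct
   images, since vertices and ends can be separated by finite cuts. So
   x |-> measure of K below x identifies exactly the ends of gaps, and sigma
   restricted to K factors through it as an injective path, that is an arc,
   which runs through its inner points in the order of sigma. *)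

(** * Loop erasure *)

(** A finite subfamily of a chain has an upper bound in the chain, so a single member replaces the
    finite subcover. *)
Lemma compact_chain_cover (T : ptopologicalType) (A : set T)
    (F : set (set T)) :
  compact A -> (forall X, F X -> open X) -> total_on F subset -> F !=set0 ->
  A `<=` \bigcup_(X in F) X -> exists2 X, F X & A `<=` X.
Proof.
rewrite compact_cover => cA oF tF [X0 FX0] AF.
have [D' D'F AD'] := cA _ F id oF AF.
suff [X FX D'X] : exists2 X, F X & forall Y, Y \in D' -> Y `<=` X.
  by exists X => // p /AD' [Y /= /D'X]; apply.
have : forall s : seq (set T), {subset s <= F} ->
    exists2 X, F X & forall Y, Y \in s -> Y `<=` X.
  elim => [|Y s IH] sF; first by exists X0.
  have [|X FX sX] := IH; first by move=> Z Zs; apply: sF; rewrite inE Zs orbT.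
  have FY : F Y by apply: set_mem; apply: sF; rewrite inE eqxx.
  have [YX|XY] := tF _ _ FY FX.
    by exists X => // Z; rewrite inE => /orP[/eqP ->|/sX].
  exists Y => // Z; rewrite inE => /orP[/eqP ->//|/sX ZX].
  exact: subset_trans XY.
by move=> /(_ D'); apply => Y; apply: D'F.
Qed.

(** Together with [closed_first_ge] this finds the two ends of the gap of [K] around a point [z] off
    [K]. *)
Lemma closed_last_le (R : realType) (K : set R) (a z : R) :
  closed K -> K a -> a <= z ->
  exists k, [/\ K k, a <= k <= z & forall l, K l -> l <= z -> l <= k].
Proof.
move=> cK Ka az.
have cI : compact (K `&` `[a, z]).
  by rewrite setIC; apply: compact_closedI => //; exact: segment_compact.
have [||k /set_mem[Kk kaz] kmax] := compact_EVT_max (f := @id R) _ cI.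
- by exists a; split => //=; rewrite in_itv /= lexx.
- by apply: continuous_subspaceT => x; exact: cvg_id.
move: (kaz); rewrite /= in_itv /= => /andP[ak kz].
exists k; rewrite ak kz; split => // l Kl lz.
have [la|al] := leP l a; first exact: le_trans ak.
by apply: kmax; rewrite inE; split => //=; rewrite in_itv /= lz ltW.
Qed.

Lemma closed_first_ge (R : realType) (K : set R) (b z : R) :
  closed K -> K b -> z <= b ->
  exists k, [/\ K k, z <= k <= b & forall l, K l -> z <= l -> k <= l].
Proof.
move=> cK Kb zb.
have cI : compact (K `&` `[z, b]).
  by rewrite setIC; apply: compact_closedI => //; exact: segment_compact.
have [||k /set_mem[Kk kzb] kmin] := compact_EVT_min (f := @id R) _ cI.
- by exists b; split => //=; rewrite in_itv /= lexx andbT.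
- by apply: continuous_subspaceT => x; exact: cvg_id.
move: (kzb); rewrite /= in_itv /= => /andP[zk kb].
exists k; rewrite zk kb; split => // l Kl zl.
have [bl|lb] := leP b l; first exact: le_trans bl.
by apply: kmin; rewrite inE; split => //=; rewrite in_itv /= zl ltW.
Qed.

(** On the compact set [K] the map [q] is closed, so a closed preimage under [sigma] is pushed
    forward to a closed preimage under [f]. *)
Lemma compact_factor_continuous (T Y Z : topologicalType) (K : set T)
    (q : T -> Y) (sigma : T -> Z) (f : Y -> Z) :
  hausdorff_space Y -> compact K ->
  {within K, continuous q} -> {within K, continuous sigma} ->
  (forall x, K x -> f (q x) = sigma x) ->
  {within q @` K, continuous f}.
Proof.
move=> hY cK cq cs fq; apply/continuous_closedP => B cB.
move: cs => /continuous_closedP /(_ B cB) /closed_subspaceP[V cV VK].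
apply/closed_subspaceP; exists (q @` (K `&` V)).
  apply: compact_closed => //; apply: continuous_compact.
    by apply: continuous_subspaceW cq => x [].
  exact: compact_closedI.
apply/seteqP; split => y /=.
  move=> [[x [Kx Vx] <-] _]; split; last by exists x.
  have [+ _] : (sigma @^-1` B `&` K) x by rewrite -VK.
  by rewrite /= /preimage /= -fq.
move=> [fB [x Kx xy]]; split; last by exists x.
exists x => //; split => //.
have : (sigma @^-1` B `&` K) x.
  by split => //; move: fB; rewrite -xy /preimage /= -fq.
by rewrite -VK => -[].
Qed.

Lemma within01_nbhs (R : realType) (X : topologicalType) (sigma : R -> X) a U :
  {within `[0, 1], continuous sigma} -> 0 <= a <= 1 -> open U -> U (sigma a) ->
  exists2 e : R, 0 < e &
    forall x : R, 0 <= x <= 1 -> `|x - a| < e -> U (sigma x).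
Proof.
move=> /subspace_continuousP cs a01 oU Ua.
have /(_ _) := cs a; rewrite /= in_itv /= => /(_ a01 U).
move=> /(_ (open_nbhs_nbhs (conj oU Ua))).
rewrite /= /within /= => /nbhs_ballP[e /= e0 He].
exists e => // x x01 xa; apply: He; last by rewrite /= in_itv.
by rewrite /ball /= distrC.
Qed.

Section loop_erasure.
Variables (R : realType) (X : topologicalType) (sigma : R -> X).
Hypotheses (hX : hausdorff_space X)
  (cs : {within `[0, 1], continuous sigma}).

(* O is a union of open intervals to be cut out of the path: each maximal one
   carries a loop. *)
Definition erasable (O : set R) := [/\ open O, O `<=` `]0, 1[ &
  forall a b, 0 <= a -> b <= 1 -> a < b -> ~ O a -> ~ O b -> `]a, b[ `<=` O ->
    sigma a = sigma b].

(** If [sigma a] and [sigma b] differed, they would have disjoint neighbourhoods [U] and [V]. By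
    compactness one member [Y] of the chain contains all of the interval from [a] to [b] but short
    pieces at its ends. The ends [a'] and [b'] of the maximal interval of [Y] found there have a
    common image, which would lie in both [U] and [V]. *)
Lemma erasable_bigcup (F : set (set R)) :
  F `<=` erasable -> total_on F subset -> erasable (\bigcup_(Y in F) Y).
Proof.
move=> Fe tF; split.
- by apply: bigcup_open => Y /Fe[].
- by move=> x [Y /Fe[_ + _]] Yx; apply.
move=> a b a0 b1 ab nOa nOb abO.
have [//|sab] := pselect (sigma a = sigma b); exfalso.
have := hX; rewrite open_hausdorff => /(_ (sigma a) (sigma b)).
case; first exact/eqP.
case=> U V /= [/set_mem Ua /set_mem Vb] [oU oV /eqP UV0].
have [|e e0 He] := within01_nbhs cs _ oU Ua; first lra.
have [|d d0 Hd] := within01_nbhs cs _ oV Vb; first lra.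
(* With [m] a third of [k], points within [m] of [a] or [b] are mapped into [U] or [V] respectively,
   and [a + m <= b - m]. *)
pose k := Num.min (Num.min e d) (b - a).
have k0 : 0 < k by rewrite !lt_min e0 d0 subr_gt0.
have : k <= Num.min (Num.min e d) (b - a) by [].
rewrite !le_min -/k => /andP[/andP[ke kd] kab]; pose m := k / 3.
have [m0 me md mab] : [/\ 0 < m, m < e, m < d & m * 3 <= b - a].
  by rewrite /m; split; lra.
have := @compact_chain_cover _ `[a + m, b - m]%classic F.
case.
- exact: segment_compact.
- by move=> Y /Fe[].
- by [].
- have [|Y FY _] := abO ((a + b) / 2); last by exists Y.
  by rewrite /= in_itv /=; lra.
- move=> x; rewrite /= in_itv /= => xab; apply: abO.
  by rewrite /= in_itv /=; lra.
move=> Y FY YI; have [oY Y01 Yg] := Fe _ FY.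
have nYa : ~ Y a by move=> ?; apply: nOa; exists Y.
have nYb : ~ Y b by move=> ?; apply: nOb; exists Y.
have cY : closed (~` Y) by exact: open_closedC.
have [|a' [Ka' aa' ma']] := @closed_last_le _ _ a (a + m) cY nYa; first lra.
have [|b' [Kb' bb' mb']] := @closed_first_ge _ _ b (b - m) cY nYb; first lra.
have E : sigma a' = sigma b'.
  apply: Yg => //; try lra.
  move=> x; rewrite /= in_itv /= => xab; apply: contrapT => nYx.
  have [x1|x1] := leP x (a + m); first by have := ma' _ nYx x1; lra.
  have [x2|x2] := leP (b - m) x; first by have := mb' _ nYx x2; lra.
  by apply: nYx; apply: YI; rewrite /= in_itv /=; lra.
have : (U `&` V) (sigma a').
  split; first by apply: He; [lra|rewrite ger0_norm; lra].
  by rewrite E; apply: Hd; [lra|rewrite ler0_norm; lra].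
by rewrite UV0.
Qed.

(** [K] is what a maximal erasable set [O] leaves of [0, 1]. If two points of [K] with equal images
    had a point of [K] between them, erasing the whole interval between them as well would
    contradict maximality. *)
Lemma loop_erasure : exists K : set R,
  [/\ closed K, K `<=` `[0, 1], K 0 /\ K 1,
    forall a b, K a -> K b -> a < b -> (forall z, a < z < b -> ~ K z) ->
      sigma a = sigma b &
    forall a b, K a -> K b -> a < b -> sigma a = sigma b ->
      forall z, a < z < b -> ~ K z].
Proof.
have [ O [[oO O01 Og] Omax]] := Zorn_bigcup erasable_bigcup.
have in01 x : (`[0, 1]%classic : set R) x <-> 0 <= x <= 1 by rewrite /= in_itv.
exists (~` O `&` `[0, 1]); split.
- by apply: closedI; [exact: open_closedC|exact: itv_closed].
- by move=> x [].
- split; split; try (by move=> /O01; rewrite /= in_itv /=; lra);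
    by apply/in01; lra.
- move=> a b [nOa /in01 a01] [nOb /in01 b01] ab gap; apply: Og => //; try lra.
  move=> z; rewrite /= in_itv /= => zab; apply: contrapT => nOz.
  by apply: (gap z) => //; split => //; apply/in01; lra.
move=> a b [nOa /in01 a01] [nOb /in01 b01] ab sab z zab [nOz _].
apply: (Omax (O `|` `]a, b[)).
  split; first by move=> x; left.
  by move=> /(_ z) H; apply: nOz; apply: H; right; rewrite /= in_itv.
split.
- by apply: openU => //; exact: itv_open.
- by move=> x [/O01 //|]; rewrite /= !in_itv /=; lra.
move=> c d c0 d1 cd nc nd cdB.
have nOc : ~ O c by move=> ?; apply: nc; left.
have nOd : ~ O d by move=> ?; apply: nd; left.
(* Neither interval, [a] to [b] or [c] to [d], has an end of the other inside it, so the two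
   coincide or are disjoint. *)
have nabc : ~ (a < c < b) by move=> ?; apply: nc; right; rewrite /= in_itv.
have nabd : ~ (a < d < b) by move=> ?; apply: nd; right; rewrite /= in_itv.
have na : ~ (c < a < d).
  by move=> ?; case: (cdB a); rewrite /= ?in_itv //= ltxx.
have nb : ~ (c < b < d).
  by move=> ?; case: (cdB b); rewrite /= ?in_itv //= ltxx andbF.
have [/andP[/eqP <- /eqP <-] //|abcd] := boolP ((a == c) && (b == d)).
apply: Og => // x xcd; case: (cdB x xcd) => // xab; exfalso.
move: xcd xab; rewrite /= !in_itv /= => xcd xab.
move: abcd; have -> : a = c by lra.
have -> : b = d by lra.
by rewrite !eqxx.
Qed.

End loop_erasure.

(* h x is the Lebesgue measure of the part of K below x. *)
Lemma measure_clock (R : realType) (K : set R) :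
  closed K -> K `<=` `[0, 1] ->
  exists h : R -> R,
  [/\ forall x y, x <= y -> 0 <= h y - h x <= y - x,
      forall x y, x <= y -> (forall z, x < z < y -> ~ K z) -> h x = h y &
      forall x y c d, x <= c -> c < d -> d <= y -> `]c, d[ `<=` K -> h x < h y].
Proof.
move=> cK K01; pose mu := @lebesgue_measure R.
have mK : measurable (K : set R) by exact: closed_measurable.
have le_mu (A B : set R) : measurable A -> measurable B -> A `<=` B ->
    (mu A <= mu B)%E.
  by move=> mA mB AB; apply: le_measure => //; rewrite inE.
have mKI (i : interval R) : measurable (K `&` [set` i]).
  by apply: measurableI => //; exact: measurable_itv.
have fK (A : set R) : measurable A -> A `<=` K -> mu A \is a fin_num.
  move=> mA AK; rewrite ge0_fin_numE; last by rewrite /mu measure_ge0.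
  apply: (@le_lt_trans _ _ (mu `[0, 1]%classic)).
    by apply: le_mu => //; exact: subset_trans K01.
  by rewrite /mu lebesgue_measure_itv /= lte_fin ltr01 -EFinB ltry.
have fKI (i : interval R) : mu (K `&` [set` i]) \is a fin_num.
  by apply: fK; [exact: mKI|exact: subIsetl].
pose h x := fine (mu (K `&` `]-oo, x])).
have hB x y : x <= y -> h y - h x = fine (mu (K `&` `]x, y])).
  move=> xy.
  have Ixy : `]-oo, y]%classic = `]-oo, x] `|` `]x, y] :> set R.
    apply/seteqP; split => z; rewrite /= !in_itv /=; last first.
      by case=> [|/andP[]]; lra.
    by case: (leP z x) => zx zy; [left|right].
  have dxy : K `&` `]-oo, x] `&` (K `&` `]x, y]) = set0 :> set R.
    apply/seteqP; split => // z; rewrite /= !in_itv /= => -[[_ +] [_]]; lra.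
  have -> : h y = h x + fine (mu (K `&` `]x, y])).
    rewrite -fineD //; congr fine; rewrite /mu -measureU;
      [by rewrite -setIUr -Ixy|exact: mKI|exact: mKI|exact: dxy].
  by rewrite addrC addKr.
exists h; split.
- move=> x y xy; rewrite hB // fine_ge0 //= -lee_fin fineK //.
  apply: (@le_trans _ _ (mu `]x, y]%classic)).
    by apply: le_mu.
  rewrite /mu lebesgue_measure_itv /= lte_fin.
  by case: ifPn => _; rewrite -?EFinB // lee_fin; lra.
- move=> x y xy nK; apply/esym/eqP; rewrite -subr_eq0 hB //.
  suff -> : mu (K `&` `]x, y]) = 0%E by [].
  apply/eqP; rewrite eq_le measure_ge0 andbT.
  (* Of the half-open interval only its right end [y] can belong to [K], and a single point has
     measure zero. *)
  rewrite -(lebesgue_measure_set1 y); apply: le_mu => //.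
  move=> z [Kz]; rewrite /= in_itv /=.
  move=> /andP[xz zy]; have [->//|nzy] := eqVneq z y; exfalso.
  by apply: (nK z) => //; rewrite xz lt_neqAle nzy zy.
move=> x y c d xc cd dy cdK; rewrite -subr_gt0 hB; last lra.
apply: (@lt_le_trans _ _ (d - c)); first lra.
rewrite -lee_fin fineK //.
have -> : (d - c)%:E = mu `]c, d[%classic.
  by rewrite /mu lebesgue_measure_itv /= lte_fin cd EFinB.
apply: le_mu => //.
move=> z zcd; split; first exact: cdK.
by move: zcd; rewrite /= !in_itv /=; lra.
Qed.

(** * Extracting an arc from a path *)

Section arc_in_path.
Variables (R : realType) (X : topologicalType) (sigma : R -> X) (D : set X).
Hypotheses (hX : hausdorff_space X)
  (cs : {within `[0, 1], continuous sigma})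
  (oD : open D) (nD0 : ~ D (sigma 0)) (nD1 : ~ D (sigma 1))
  (injD : forall x y : R, 0 <= x <= 1 -> 0 <= y <= 1 -> D (sigma x) ->
    sigma x = sigma y -> x = y)
  (sepD : forall p q, ~ D p -> ~ D q -> p <> q -> exists U V,
    [/\ open U, open V, U p, V q &
      (forall r, U r -> ~ V r) /\ (forall r, ~ D r -> U r \/ V r)]).

Section loop_free.
Variable K : set R.
Hypotheses (cK : closed K) (K01 : K `<=` `[0, 1]) (K0 : K 0) (K1 : K 1)
  (Kgap : forall a b, K a -> K b -> a < b -> (forall z, a < z < b -> ~ K z) ->
      sigma a = sigma b).

Let in01 x : K x -> 0 <= x <= 1.
Proof. by move=> /K01; rewrite /= in_itv. Qed.

(** A nearby [z] off [K] would lie in a gap of [K]. The end of this gap on the side of [x] is also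
    near [x], so its image is in [D]; but the other end has the same image, against [injD]. *)
Lemma loop_free_nbhs x : K x -> D (sigma x) ->
  exists2 e : R, 0 < e & forall z : R, `|z - x| < e -> K z /\ D (sigma z).
Proof.
move=> Kx Dx; have x01 := in01 Kx.
have [e e0 He] := within01_nbhs cs x01 oD Dx.
have x0 : x != 0 by apply/eqP => x0; apply: nD0; rewrite -x0.
have x1 : x != 1 by apply/eqP => x1; apply: nD1; rewrite -x1.
have {x0 x1} [x0 x1] : 0 < x /\ x < 1.
  by rewrite lt_neqAle eq_sym x0 lt_neqAle x1 /=; case/andP: x01.
exists (Num.min e (Num.min x (1 - x))).
  by rewrite !lt_min e0 x0 subr_gt0 x1.
move=> z; rewrite !lt_min => /and3P[ze zx zx1].
have z01 : 0 <= z <= 1 by move: zx zx1; rewrite !ltr_distl; lra.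
split; last exact: He.
apply: contrapT => nKz.
have [|a [Ka /andP[a0 az] amax]] := closed_last_le cK K0 (z := z); first lra.
have [|b [Kb /andP[zb b1] bmin]] := closed_first_ge cK K1 (z := z); first lra.
have az' : a != z by apply/eqP => az'; apply: nKz; rewrite -az'.
have bz' : z != b by apply/eqP => bz'; apply: nKz; rewrite bz'.
have {}az : a < z by rewrite lt_neqAle az' az.
have {}zb : z < b by rewrite lt_neqAle bz' zb.
have sab : sigma a = sigma b.
  apply: Kgap => //; first lra.
  move=> y yab Ky; have [yz|zy] := leP y z; first by have := amax _ Ky yz; lra.
  by have := bmin _ Ky (ltW zy); lra.
move: ze; rewrite ltr_distl => ze.
have [zx'|xz] := leP z x.
  have bx : b <= x by exact: bmin.
  have Db : D (sigma b) by apply: He; [lra|rewrite ltr_distl; lra].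
  have := injD _ _ Db (esym sab); rewrite !in01 // => /(_ isT isT); lra.
have xa : x <= a by apply: amax => //; exact: ltW.
have Da : D (sigma a) by apply: He; [lra|rewrite ltr_distl; lra].
have := injD _ _ Da sab; rewrite !in01 // => /(_ isT isT); lra.
Qed.

(* Otherwise a last point of K in [a, b] whose image is on the side of sigma a
   starts a gap of K, whose two ends have the same image. *)
Lemma loop_free_flat a b : K a -> K b -> a < b ->
  (forall z, a < z < b -> K z -> ~ D (sigma z)) -> sigma a = sigma b.
Proof.
move=> Ka Kb ab nD; apply: contrapT => sab.
have a01 := in01 Ka; have b01 := in01 Kb.
(* The assumption on the points strictly between [a] and [b] extends to [a] and [b]: by
   [loop_free_nbhs], an image in [D] there would spread to points of [K] inside the interval. *)
have nDa : ~ D (sigma a).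
  move=> Da; have [e e0 He] := loop_free_nbhs Ka Da.
  pose m := Num.min e (b - a).
  have m0 : 0 < m by rewrite lt_min e0 subr_gt0.
  have : m <= Num.min e (b - a) by []; rewrite le_min => /andP[me mb].
  have [|Kz Dz] := He (a + m / 2); first by rewrite ltr_distl; lra.
  by apply: nD Kz Dz; lra.
have nDb : ~ D (sigma b).
  move=> Db; have [e e0 He] := loop_free_nbhs Kb Db.
  pose m := Num.min e (b - a).
  have m0 : 0 < m by rewrite lt_min e0 subr_gt0.
  have : m <= Num.min e (b - a) by []; rewrite le_min => /andP[me mb].
  have [|Kz Dz] := He (b - m / 2); first by rewrite ltr_distl; lra.
  by apply: nD Kz Dz; lra.
have {}nD z : a <= z <= b -> K z -> ~ D (sigma z).
  move=> zab; have [->//|az] := eqVneq z a; have [->//|bz] := eqVneq z b.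
  by apply: nD; rewrite !lt_neqAle bz eq_sym az.
have [U [V [oU oV Ua Vb [UV covUV]]]] := sepD nDa nDb sab.
(* [W] is a closed set of reals that marks the points of [0, 1] with image off [V]; for points of
   [K] in [a, b] this means image in [U]. *)
have [W cW WV] : exists2 W : set R, closed W &
    W `&` `[0, 1] = (sigma @^-1` (~` V)) `&` `[0, 1].
  apply/closed_subspaceP; move/continuous_closedP : cs; apply.
  exact: open_closedC.
have WP z : 0 <= z <= 1 -> W z <-> ~ V (sigma z).
  move=> z01; have Iz : (`[0, 1]%classic : set R) z by rewrite /= in_itv.
  split => [Wz|nVz].
    by have : (W `&` `[0, 1]) z by []; rewrite WV => -[].
  by have : (sigma @^-1` (~` V) `&` `[0, 1]) z by []; rewrite -WV => -[].
have cKW : closed (K `&` W) by exact: closedI.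
have KWa : (K `&` W) a by split => //; apply/WP => //; exact: UV.
have [k [[Kk Wk] /andP[ak kb] kmax]] := closed_last_le cKW KWa (ltW ab).
have k01 := in01 Kk.
have nVk : ~ V (sigma k) by apply/WP.
have Uk : U (sigma k).
  by have [|//|//] := covUV (sigma k); apply: nD => //; rewrite ak.
have {}kb : k < b.
  by rewrite lt_neqAle kb andbT; apply/eqP => kb'; apply: nVk; rewrite kb'.
have [e e0 He] := within01_nbhs cs k01 oU Uk.
pose m := Num.min e (b - k).
have m0 : 0 < m by rewrite lt_min e0 subr_gt0.
have : m <= Num.min e (b - k) by []; rewrite le_min => /andP[me mb].
(* No point of [K] lies strictly between [k] and [k']: before [k + m / 2] its image would be in [U],
   hence off [V], although [k] is the last such point. So [k] and [k'] have the same image, and [k']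
   itself contradicts the choice of [k]. *)
have [|k' [Kk' /andP[mk' k'b] k'min]] :=
  closed_first_ge cK Kb (z := k + m / 2); first lra.
have k'01 := in01 Kk'.
have skk' : sigma k = sigma k'.
  apply: Kgap => //; first lra.
  move=> z zkk' Kz; have [zm|mz] := ltP z (k + m / 2); last first.
    by have := k'min _ Kz mz; lra.
  have z01 := in01 Kz.
  have nVz : ~ V (sigma z).
    by apply: UV; apply: He => //; rewrite ltr_distl; lra.
  have KWz : (K `&` W) z by split => //; apply/WP.
  by have : z <= k by [apply: kmax => //; lra]; lra.
have KWk' : (K `&` W) k' by split => //; apply/WP => //; rewrite -skk'.
by have := kmax _ KWk' k'b; lra.
Qed.

(** [q] is the function of [measure_clock] rescaled to run from 0 to 1. Between points of [K] with
    distinct images there is a point of [K] with image in [D], and the interval of [K] around it has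
    positive measure. *)
Lemma loop_free_clock : sigma 0 <> sigma 1 -> exists q : R -> R,
  [/\ continuous q, q 0 = 0, q 1 = 1, {homo q : x y / x <= y} &
   [/\ forall x y, x <= y -> (forall z, x < z < y -> ~ K z) -> q x = q y &
   forall a b, K a -> K b -> a < b -> sigma a <> sigma b ->
     exists z, [/\ K z, D (sigma z) & q a < q z < q b]]].
Proof.
move=> s01; have [h [hle hflat hlt]] := measure_clock cK K01.
have hinc a b : K a -> K b -> a < b -> sigma a <> sigma b ->
    exists z, [/\ K z, D (sigma z) & h a < h z < h b].
  move=> Ka Kb ab sab.
  have [z [zab Kz Dz]] : exists z, [/\ a < z < b, K z & D (sigma z)].
    apply: contrapT => nz; apply: sab; apply: loop_free_flat => // z zab Kz Dz.
    by apply: nz; exists z.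
  have [e e0 He] := loop_free_nbhs Kz Dz.
  exists z; split => //; pose m := Num.min e (Num.min (z - a) (b - z)).
  have m0 : 0 < m by rewrite !lt_min e0; lra.
  have : m <= Num.min e (Num.min (z - a) (b - z)) by [].
  rewrite !le_min => /and3P[me ma mb].
  apply/andP; split.
    apply: (hlt _ _ (z - m) z); [lra|lra|lra|].
    move=> y; rewrite /= in_itv /= => yz.
    by apply: (He y _).1; rewrite ltr_distl; lra.
  apply: (hlt _ _ z (z + m)); [lra|lra|lra|].
  move=> y; rewrite /= in_itv /= => yz.
  by apply: (He y _).1; rewrite ltr_distl; lra.
have h01 : 0 < h 1 - h 0.
  by have [z [_ _]] := hinc 0 1 K0 K1 ltr01 s01; lra.
have ih01 : 0 < (h 1 - h 0)^-1 by rewrite invr_gt0.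
(* By [hle], [h] is 1-Lipschitz. *)
have ch : continuous h.
  move=> x; apply/cvgrPdist_lt => e e0; near=> y.
  apply: (@le_lt_trans _ _ `|x - y|); last by near: y; exact: cvgr_dist_lt.
  have [xy|/ltW yx] := leP x y.
    by rewrite !ler0_norm; have := hle _ _ xy; lra.
  by rewrite !ger0_norm; have := hle _ _ yx; lra.
exists (fun x => (h x - h 0) / (h 1 - h 0)); split.
- move=> x; apply: cvgM; last exact: cvg_cst.
  by apply: cvgB; [exact: ch|exact: cvg_cst].
- by rewrite subrr mul0r.
- by rewrite mulfV // gt_eqF.
- by move=> x y xy; rewrite ler_pM2r //; have := hle _ _ xy; lra.
split; first by move=> x y xy nK; rewrite (hflat x y).
move=> a b Ka Kb ab sab; have [z [Kz Dz hz]] := hinc a b Ka Kb ab sab.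
by exists z; split => //; rewrite !ltr_pM2r //; lra.
Unshelve. all: by end_near.
Qed.

End loop_free.

(** [f] is [sigma] on [K], reparametrised by the clock [q]. The last two clauses let [f] inherit the
    order of a walk and determine the ends of every other witness of the arc. *)
Lemma arc_in_path : sigma 0 <> sigma 1 -> exists (f : R -> X) A,
  [/\ homeo01 f A /\ A `<=` sigma @` `[0, 1],
      f 0 = sigma 0, f 1 = sigma 1,
      forall u v : R, 0 <= u <= 1 -> 0 <= v <= 1 -> D (f u) -> D (f v) ->
        exists x y : R, [/\ 0 <= x <= 1, 0 <= y <= 1, f u = sigma x,
          f v = sigma y & (x < y <-> u < v)] &
      forall u v : R, 0 <= u -> u < v -> v <= 1 ->
        exists2 w : R, u < w < v & D (f w)].
Proof.
move=> s01; have [K [cK K01 [K0 K1] Kgap Kmin]] := loop_erasure hX cs.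
have [q [cq q0 q1 qmono [qflat qinc]]] :=
  loop_free_clock cK K01 K0 K1 Kgap s01.
have in01 x : K x -> 0 <= x <= 1 by move=> /K01; rewrite /= in_itv.
have Iin x : (`[0, 1]%classic : set R) x <-> 0 <= x <= 1 by rewrite /= in_itv.
have q01 x : K x -> 0 <= q x <= 1.
  by move=> /in01 /andP[x0 x1]; rewrite -q0 -q1 !qmono.
have qsurj u : 0 <= u <= 1 -> exists2 x, K x & q x = u.
  move=> u01; have [|||x /andP[x0 x1] <-] := @IVT _ q 0 1 u.
  - exact: ler01.
  - exact: continuous_subspaceT.
  - by rewrite q0 q1 minEle maxEle ler01.
  (* The intermediate value [x] may lie off [K]; the last point of [K] up to [x] has the same clock
     value. *)
  have [|k [Kk /andP[k0 kx] kmax]] := closed_last_le cK K0 (z := x) => //.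
  exists k => //; apply: qflat => // z /andP[kz zx] Kz.
  by have := kmax _ Kz (ltW zx); rewrite leNgt kz.
pose f u := sigma (xget 0 [set x | K x /\ q x = u]).
have qlt x y : K x -> K y -> q x = q y -> x < y -> sigma x = sigma y.
  move=> Kx Ky qxy xy; apply: contrapT => sxy.
  by have [z [_ _]] := qinc _ _ Kx Ky xy sxy; rewrite qxy; lra.
have fq x : K x -> f (q x) = sigma x.
  move=> Kx; rewrite /f; case: xgetP => [y _ [Ky qyx]|/(_ x)]; last first.
    by case; split.
  have [xy|yx|->//] := ltgtP x y; last exact: qlt.
  by apply/esym/qlt.
(* Distinct points of [K] with a common image are the ends of a gap, and [q] agrees at these. *)
have finj u v : 0 <= u <= 1 -> 0 <= v <= 1 -> f u = f v -> u = v.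
  move=> /qsurj[x Kx <-] /qsurj[y Ky <-]; rewrite !fq // => sxy.
  have [xy|yx|->//] := ltgtP x y.
    by apply: qflat; [exact: ltW|exact: Kmin].
  by apply/esym/qflat; [exact: ltW|exact: Kmin].
have qK : q @` K = `[0, 1]%classic.
  apply/seteqP; split => u; first by move=> [x Kx <-]; apply/Iin/q01.
  by move=> /Iin /qsurj[x Kx <-]; exists x.
have kK : compact K.
  rewrite -(setIidr K01); apply: compact_closedI => //; exact: segment_compact.
have cf : {within `[0, 1], continuous f}.
  rewrite -qK; apply: compact_factor_continuous kK _ _ fq.
  - exact: Rhausdorff.
  - exact: continuous_subspaceT.
  - exact: continuous_subspaceW cs.
exists f, (f @` `[0, 1]%classic); split.
- split; last first.
    move=> _ [u /Iin /qsurj[x Kx <-] <-]; rewrite fq //.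
    by exists x => //; exact: K01.
  split => //; pose g p := xget 0 [set u | 0 <= u <= 1 /\ f u = p].
  have gf u : (`[0, 1]%classic : set R) u -> g (f u) = u.
    move=> /Iin u01; rewrite /g; case: xgetP => [v _ [v01 fvu]|/(_ u)].
      exact: finj.
    by case; split.
  exists g => //.
  apply: (compact_factor_continuous hX _ cf _ gf); first exact: segment_compact.
  by apply: continuous_subspaceT => x; exact: cvg_id.
- by rewrite -[in LHS]q0 fq.
- by rewrite -[in LHS]q1 fq.
- move=> u v /qsurj[x Kx <-] /qsurj[y Ky <-]; rewrite !fq // => Dx Dy.
  exists x, y; split => //; [exact: in01|exact: in01|split => [xy|]].
    (* Equal clock values would give equal images, which [injD] rules out for distinct points with
       image in [D]. *)
    rewrite lt_neqAle qmono ?ltW // andbT; apply/eqP => qxy.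
    have xyE : x = y.
      by apply: injD (in01 _ Kx) (in01 _ Ky) Dx (qlt _ _ Kx Ky qxy xy).
    by move: xy; rewrite xyE ltxx.
  by rewrite !ltNge; apply: contra => /qmono.
move=> u v u0 uv v1.
have [x Kx qx] : exists2 x, K x & q x = u by apply: qsurj; lra.
have [y Ky qy] : exists2 y, K y & q y = v by apply: qsurj; lra.
have xy : x < y.
  by rewrite ltNge; apply/negP => /qmono; rewrite qx qy; lra.
have [|z [Kz Dz qz]] := qinc _ _ Kx Ky xy.
  rewrite -!fq // qx qy => fuv.
  have uvE : u = v by apply: finj => //; lra.
  by move: uv; rewrite uvE ltxx.
by exists (q z); rewrite ?fq // -qx -qy.
Qed.

End arc_in_path.

(** * Ends and components *)

Section connectivity.
Variable G : digraph.
Implicit Types (S C : set (vertex G)) (u v x : vertex G) (r : ray G)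
  (w : graph_end G).

Lemma joins_sym (e : edge G) u v : joins e u v -> joins e v u.
Proof. by case=> H; [right|left]. Qed.

Lemma connected_off_notin S u v : connected_off S u v -> ~ S u /\ ~ S v.
Proof. by elim=> // {}v w e _ [? _]. Qed.

Lemma connected_off_trans S u v x :
  connected_off S u v -> connected_off S v x -> connected_off S u x.
Proof.
by move=> uv; elim=> // {}x y e _ ux xy Sy; exact: connected_off_step xy Sy.
Qed.

Lemma connected_off_sym S u v : connected_off S u v -> connected_off S v u.
Proof.
elim=> [|{}v x e uv vu vx Sx]; first exact: connected_off_refl.
apply: connected_off_trans vu; have [_ Sv] := connected_off_notin uv.
by apply: connected_off_step (joins_sym vx) Sv; exact: connected_off_refl.
Qed.

Lemma connected_off_sub S S' u v :
  S `<=` S' -> connected_off S' u v -> connected_off S u v.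
Proof.
move=> SS'; elim=> [Su|{}v w e _ uv vw Sw].
  by apply: connected_off_refl => /SS'.
by apply: connected_off_step uv vw _ => /SS'.
Qed.

Lemma component_notin S C v : is_component S C -> C v -> ~ S v.
Proof. by move=> [u _ ->] uv; have [] := connected_off_notin uv. Qed.

Lemma component_connected S C u v : is_component S C -> C u ->
  C v <-> connected_off S u v.
Proof.
move=> [x _ ->] /= xu; split=> [xv|]; last exact: connected_off_trans.
by apply: connected_off_trans xv; exact: connected_off_sym.
Qed.

Lemma component_joins S C (e : edge G) u v : is_component S C -> C u ->
  joins e u v -> C v \/ S v.
Proof.
move=> cC Cu uv; have [Sv|nSv] := pselect (S v); [by right|left].
apply/(component_connected v cC Cu); apply: connected_off_step uv nSv.
by apply: connected_off_refl; exact: component_notin Cu.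
Qed.

Lemma components_disjoint S C C' v : is_component S C -> is_component S C' ->
  C v -> C' v -> C = C'.
Proof.
move=> cC cC' Cv C'v; apply/seteqP; split => u.
  by move/(component_connected u cC Cv)/(component_connected u cC' C'v).
by move/(component_connected u cC' C'v)/(component_connected u cC Cv).
Qed.

Lemma ray_leaves S r : finite_set S ->
  exists N, forall n, (N <= n)%N -> ~ S (ray_vertex r n).
Proof.
move=> fS.
have : finite_set (ray_vertex r @^-1` S).
  by apply: finite_preimage => // m n _ _; exact: ray_inj.
move=> /finite_seqP[s sE]; exists (\max_(i <- s) i).+1 => n Nn Sn.
have : (ray_vertex r @^-1` S) n by [].
rewrite sE /= => ns; have := @leq_bigmax_seq _ s xpredT id n ns isT.
by rewrite leqNgt Nn.
Qed.

Lemma ray_connected S r N : (forall n, (N <= n)%N -> ~ S (ray_vertex r n)) ->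
  forall n, (N <= n)%N -> connected_off S (ray_vertex r N) (ray_vertex r n).
Proof.
move=> rS; elim=> [|n IH] Nn.
  have : N = 0%N by apply/eqP; rewrite -leqn0.
  by move=> <-; apply: connected_off_refl; exact: rS.
move: (Nn); rewrite leq_eqVlt => /orP[/eqP <-|Nn'].
  by apply: connected_off_refl; exact: rS.
by apply: connected_off_step (IH Nn') (ray_joins r n) _; exact: rS.
Qed.

(** [S] together with the initial vertices of both rays is still finite, so it does not separate
    them: some path off it joins their tails, and the tails lead back to [N] and [N']. *)
Lemma ray_equiv_connected S r r' N N' : finite_set S -> ray_equiv r r' ->
  (forall n, (N <= n)%N -> ~ S (ray_vertex r n)) ->
  (forall n, (N' <= n)%N -> ~ S (ray_vertex r' n)) ->
  connected_off S (ray_vertex r N) (ray_vertex r' N').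
Proof.
move=> fS rr' rS r'S.
pose S' := S `|` (ray_vertex r @` `I_N `|` ray_vertex r' @` `I_N').
have fS' : finite_set S'.
  rewrite !finite_setU; split => //.
  by split; apply: finite_image; exact: finite_II.
apply: contrapT => nc; apply: rr'; exists S' => // m n mn.
have [nm nn] := connected_off_notin mn; apply: nc.
have Nm : (N <= m)%N.
  by rewrite leqNgt; apply/negP => mN; apply: nm; right; left; exists m.
have Nn : (N' <= n)%N.
  by rewrite leqNgt; apply/negP => nN; apply: nn; right; right; exists n.
apply: connected_off_trans (ray_connected rS Nm) _.
apply: connected_off_trans (connected_off_sym (ray_connected r'S Nn)).
by apply: connected_off_sub mn; left.
Qed.

Lemma ray_equiv_sym r r' : ray_equiv r r' -> ray_equiv r' r.
Proof.
move=> rr' [S fS sS]; apply: rr'; exists S => // m n mn.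
by apply: (sS n m); exact: connected_off_sym.
Qed.

Lemma ray_equiv_trans r r' r'' :
  ray_equiv r r' -> ray_equiv r' r'' -> ray_equiv r r''.
Proof.
move=> rr' r'r'' [S fS sS].
have [[N rN] [N' rN'] [N'' rN'']] :=
  And3 (ray_leaves r fS) (ray_leaves r' fS) (ray_leaves r'' fS).
apply: (sS N N''); apply: connected_off_trans
  (ray_equiv_connected fS rr' rN rN') (ray_equiv_connected fS r'r'' rN' rN'').
Qed.

Lemma ray_equiv_end w r r' : sval w r -> sval w r' <-> ray_equiv r r'.
Proof.
case: w => w [r0 wE] /=; rewrite wE /= => r0r; split.
  by apply: ray_equiv_trans; exact: ray_equiv_sym.
exact: ray_equiv_trans.
Qed.

Lemma graph_end_ray w : exists r, sval w r.
Proof.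
case: w => w [r wE] /=; exists r; rewrite wE /= => -[S fS sS].
have [N rN] := ray_leaves r fS.
by apply: (sS N N); apply: connected_off_refl; exact: rN.
Qed.

Lemma graph_end_eq w w' r r' : sval w r -> sval w' r' -> ray_equiv r r' ->
  w = w'.
Proof.
move=> wr w'r' rr'.
have : sval w = sval w'.
  apply/seteqP; split => x.
    move/(ray_equiv_end x wr) => rx; apply/(ray_equiv_end x w'r').
    by apply: ray_equiv_trans rx; exact: ray_equiv_sym.
  move/(ray_equiv_end x w'r') => rx; apply/(ray_equiv_end x wr).
  exact: ray_equiv_trans rx.
by case: w w' {wr w'r'} => [w ew] [w' ew'] /= E; exact: eq_exist.
Qed.

Definition ray_shift r (N : nat) : ray G.
Proof.
apply: (@Ray G (fun n => ray_vertex r (N + n)) (fun n => ray_edge r (N + n))).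
  by move=> m n /ray_inj /addnI.
by move=> n; rewrite addnS; exact: ray_joins.
Defined.

Lemma ray_shift_equiv r N : ray_equiv r (ray_shift r N).
Proof.
move=> [S fS sS]; have [M rM] := ray_leaves r fS.
apply: (sS (N + M)%N M); apply: connected_off_refl; apply: rM.
exact: leq_addl.
Qed.

Lemma end_component S w : finite_set S ->
  exists2 C, is_component S C & has_ray_in w C.
Proof.
move=> fS; have [r wr] := graph_end_ray w; have [N rN] := ray_leaves r fS.
exists [set v | connected_off S (ray_vertex r N) v].
  by exists (ray_vertex r N) => //; exact: rN.
exists (ray_shift r N).
  by apply/(ray_equiv_end _ wr); exact: ray_shift_equiv.
by move=> n /=; apply: ray_connected => //; exact: leq_addr.
Qed.

(** [r] eventually avoids [S], and from then on it is connected off [S] to the equivalent ray inside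
    [C]. *)
Lemma has_ray_in_tail S C w r : finite_set S -> is_component S C ->
  has_ray_in w C -> sval w r ->
  exists N, forall n, (N <= n)%N -> C (ray_vertex r n).
Proof.
move=> fS cC [r' wr' Cr'] wr; have [N rN] := ray_leaves r fS.
have r'r : ray_equiv r' r by apply/(ray_equiv_end _ wr').
exists N => n Nn; apply/(component_connected _ cC (Cr' 0%N)).
apply: connected_off_trans (ray_connected rN Nn).
by apply: ray_equiv_connected => // m _; exact: component_notin (Cr' m).
Qed.

(** One ray of [w] has tails in both components, which therefore share a vertex. *)
Lemma end_component_unique S C C' w : finite_set S -> is_component S C ->
  is_component S C' -> has_ray_in w C -> has_ray_in w C' -> C = C'.
Proof.
move=> fS cC cC' wC wC'; have [r wr] := graph_end_ray w.
have [N rN] := has_ray_in_tail fS cC wC wr.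
have [N' rN'] := has_ray_in_tail fS cC' wC' wr.
apply: (components_disjoint cC cC' (v := ray_vertex r (maxn N N'))).
  by apply: rN; exact: leq_maxl.
by apply: rN'; exact: leq_maxr.
Qed.

Lemma ends_separated w w' : w <> w' -> exists S C,
  [/\ finite_set S, is_component S C, has_ray_in w C & ~ has_ray_in w' C].
Proof.
move=> ww'; have [r wr] := graph_end_ray w; have [r' wr'] := graph_end_ray w'.
have /contrapT[S fS sS] : ~ ray_equiv r r'.
  by move=> rr'; apply: ww'; exact: graph_end_eq rr'.
have [C cC wC] := end_component w fS; exists S, C; split => // w'C.
have [N rN] := has_ray_in_tail fS cC wC wr.
have [N' rN'] := has_ray_in_tail fS cC w'C wr'.
apply: (sS N N'); apply/(component_connected _ cC); first exact: rN.
exact: rN'.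
Qed.

End connectivity.

(** * The topology of the Freudenthal compactification *)
Section space.
Variables (R : realType) (G : digraph).
Implicit Types (S C : set (vertex G)) (p q : freudenthal R G).

Lemma open_basic_open (U : set (freudenthal R G)) : basic_open U -> open U.
Proof.
move=> bU; exists [set U]; last by rewrite bigcup_set1.
by move=> _ ->; exact: finI_from1.
Qed.

Lemma open_vertex_nbhd (v : vertex G) (eps : R) :
  0 < eps <= 1 -> open (vertex_nbhd v eps).
Proof. by move=> e01; apply: open_basic_open; apply: Or31; exists v, eps. Qed.

Lemma open_inner_nbhd (e : edge G) (a b : R) : open (inner_nbhd e a b).
Proof. by apply: open_basic_open; apply: Or32; exists e, a, b. Qed.

Lemma open_end_nbhd (w : graph_end G) S C (eps : R) : finite_set S ->
  is_component S C -> has_ray_in w C -> 0 < eps <= 1 -> open (end_nbhd S C eps).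
Proof.
move=> fS cC wC e01; apply: open_basic_open; apply: Or33.
by exists w, S, C, eps.
Qed.

Lemma open_locally (A : set (freudenthal R G)) :
  (forall p, A p -> exists U, [/\ open U, U p & U `<=` A]) -> open A.
Proof.
move=> H; rewrite openE => p /H[U [oU Up UA]].
by apply: filterS UA _; exact: open_nbhs_nbhs.
Qed.

Lemma open_edges_interior : open (@edges_interior R G).
Proof.
apply: bigcup_open => e _.
have -> : edge_interior e = inner_nbhd e (0 : R) 1; last exact: open_inner_nbhd.
apply/seteqP; split => [_ [x ->]|]; first by case: x => x x01 /=; split.
by case=> [v|e' x|w] //= [-> _]; exists x.
Qed.

Lemma not_edges_interior p : ~ edges_interior p <-> vertex_or_end p.
Proof.
split=> [|[[v _ <-]|[w _ <-]] [e _ [x]]//].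
case: p => [v _|e x []|w _]; [by left; exists v| |by right; exists w].
by exists e => //; exists x.
Qed.

(* The complement of end_nbhd S C 2^-1, minus the points at which C is cut off
   from S. *)
Definition cut_off C : set (freudenthal R G) := fun p =>
  match p with
  | VertexPt u => ~ C u
  | InnerPt e x =>
      [\/ ~ C (etail e) /\ ~ C (ehead e),
          ~ C (etail e) /\ sval x < 2^-1 |
          ~ C (ehead e) /\ 2^-1 < sval x]
  | EndPt w => ~ has_ray_in w C
  end.

(** As [C] is not assumed to contain a ray, this set is not given as a basic open set, and each
    point gets its own neighbourhood. Around a vertex of [C] radius one half works because every
    edge there leads to [C] or to [S]. *)
Lemma open_component_nbhd S C : finite_set S -> is_component S C ->
  open (end_nbhd S C (2^-1 : R)).
Proof.
move=> fS cC; have h01 : 0 < (2^-1 : R) <= 1 by lra.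
apply: open_locally => -[v Cv|e x|w wC]; last first.
- by exists (end_nbhd S C 2^-1); split => //; exact: open_end_nbhd wC _.
- case=> [[Ct Ch]|[Ct Sh xh]|[St Ch xh]].
  + exists (inner_nbhd e 0 1); split; first exact: open_inner_nbhd.
      by split => //; exact: valP x.
    by case=> [|e' y|] //= [-> _]; apply: Or31.
  + exists (inner_nbhd e 0 2^-1); split; first exact: open_inner_nbhd.
      by split => //; have := valP x; rewrite /= in xh *; lra.
    by case=> [|e' y|] //= [-> y2]; apply: Or32; split => //; lra.
  + exists (inner_nbhd e 2^-1 1); split; first exact: open_inner_nbhd.
      by split => //; have := valP x; rewrite /= in xh *; lra.
    by case=> [|e' y|] //= [-> y2]; apply: Or33; split => //; lra.
exists (vertex_nbhd v 2^-1); split => //; first exact: open_vertex_nbhd.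
case=> [u ->|e x|] //= [[tv xh]|[hv xh]].
  have je : joins e v (ehead e) by left.
  have [Ch|Sh] := component_joins cC Cv je.
    by apply: Or31; rewrite tv.
  by apply: Or32; rewrite tv.
have je : joins e v (etail e) by right.
have [Ct|St] := component_joins cC Cv je.
  by apply: Or31; rewrite hv.
by apply: Or33; rewrite hv.
Qed.

(** An end without a ray in [C] has one in another component [C'] for the same [S], and the
    neighbourhood given by [S] and [C'] stays clear of [C]. *)
Lemma open_cut_off S C : finite_set S -> is_component S C -> open (cut_off C).
Proof.
move=> fS cC; have h01 : 0 < (2^-1 : R) <= 1 by lra.
apply: open_locally => -[v nCv|e x|w nwC]; last first.
- have [C' cC' wC'] := end_component w fS.
  have dCC' v : C' v -> ~ C v.
    move=> C'v Cv; apply: nwC.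
    by rewrite (components_disjoint cC cC' Cv C'v).
  exists (end_nbhd S C' 2^-1); split => //; first exact: open_end_nbhd wC' _.
  case=> [v|e x|w'] /=; first exact: dCC'.
    case=> [[/dCC' ? /dCC' ?]|[/dCC' ? _ ?]|[_ /dCC' ? ?]].
    + exact: Or31.
    + exact: Or32.
    + by apply: Or33; split => //; lra.
  move=> w'C' w'C; apply: nwC.
  by rewrite (end_component_unique fS cC cC' w'C w'C').
- case=> [[nt nh]|[nt xh]|[nh xh]].
  + exists (inner_nbhd e 0 1); split; first exact: open_inner_nbhd.
      by split => //; exact: valP x.
    by case=> [|e' y|] //= [-> _]; apply: Or31.
  + exists (inner_nbhd e 0 2^-1); split; first exact: open_inner_nbhd.
      by split => //; have := valP x; rewrite /= in xh *; lra.
    by case=> [|e' y|] //= [-> y2]; apply: Or32; split => //; lra.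
  + exists (inner_nbhd e 2^-1 1); split; first exact: open_inner_nbhd.
      by split => //; have := valP x; rewrite /= in xh *; lra.
    by case=> [|e' y|] //= [-> y2]; apply: Or33; split => //; lra.
exists (vertex_nbhd v 2^-1); split => //; first exact: open_vertex_nbhd.
case=> [u ->|e x|] //= [[tv xh]|[hv xh]].
  by apply: Or32; rewrite tv.
by apply: Or33; rewrite hv; split => //; lra.
Qed.

Lemma cut_off_disjoint S C p : is_component S C ->
  end_nbhd S C 2^-1 p -> ~ cut_off C p.
Proof.
move=> cC; case: p => [v|e x|w] /=; [by move=> ? ?| |by move=> ? ?].
case=> [[Ct Ch]|[Ct Sh xh]|[St Ch xh]] [[nt nh]|[nt yh]|[nh yh]] //; lra.
Qed.

Lemma cut_off_cover S C p : vertex_or_end p ->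
  end_nbhd S C 2^-1 p \/ cut_off C p.
Proof. by case=> -[v _ <-]; exact: lem. Qed.

Definition separated_by p q := exists S C,
  [/\ finite_set S, is_component S C, end_nbhd S C 2^-1 p & cut_off C q].

Lemma vertex_or_end_separated p q : vertex_or_end p -> vertex_or_end q ->
  p <> q -> separated_by p q \/ separated_by q p.
Proof.
(* For a vertex and an end, the end goes on the side of the component, with the vertex alone as the
   cut. *)
have ve (v : vertex G) (w : graph_end G) :
    separated_by (EndPt w) (VertexPt v).
  have f1 : finite_set [set v] by exact: finite_set1.
  have [C cC wC] := end_component w f1; exists [set v], C; split => //=.
  by move=> /(component_notin cC); apply.
case=> -[v _ <-] [[u _ <-]|[u _ <-]] pq; [left|by right|by left|left].
- exists [set u], [set x | connected_off [set u] v x].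
  have vu : ~ [set u] v by move=> /= vu; apply: pq; rewrite vu.
  split; [exact: finite_set1|by exists v|exact: connected_off_refl|].
  by move=> /= vu'; have [_] := connected_off_notin vu'; apply.
- have [|S [C [fS cC vC uC]]] := @ends_separated _ v u.
    by move=> vu; apply: pq; rewrite vu.
  by exists S, C.
Qed.

(** This supplies the hypothesis [sepD] of [arc_in_path] when [D] is the set of inner points of
    edges: cutting edges at their midpoints leaves every vertex and end on one of the two sides. *)
Lemma vertex_or_end_clopen p q : vertex_or_end p -> vertex_or_end q ->
  p <> q -> exists U V : set (freudenthal R G),
    [/\ open U, open V, U p, V q &
      (forall r, U r -> ~ V r) /\ (forall r, vertex_or_end r -> U r \/ V r)].
Proof.
move=> vp vq pq.
have [] := vertex_or_end_separated vp vq pq => -[S [C [fS cC ? ?]]];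
  have oU := open_component_nbhd fS cC; have oV := open_cut_off fS cC.
- exists (end_nbhd S C 2^-1), (cut_off C); split => //; split => r.
    exact: cut_off_disjoint cC.
  exact: cut_off_cover.
- exists (cut_off C), (end_nbhd S C 2^-1); split => //; split => r.
    by move=> Vr /(cut_off_disjoint cC).
  by move=> /(cut_off_cover S C)[]; [right|left].
Qed.

Lemma inner_point_separated (e : edge G) x q : InnerPt e x <> q ->
  exists U V : set (freudenthal R G),
    [/\ open U, open V, U (InnerPt e x), V q & forall r, U r -> ~ V r].
Proof.
have x01 := valP x; rewrite /= in x01.
case: q => [v _|e' y xy|w _].
- pose m := Num.min (sval x) (1 - sval x).
  have m0 : 0 < m by rewrite lt_min subr_gt0.
  have : m <= Num.min (sval x) (1 - sval x) by [].
  rewrite le_min => /andP[mx m1x].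
  exists (inner_nbhd e (m / 2) (1 - m / 2)), (vertex_nbhd v (m / 2)).
  split => //.
  + exact: open_inner_nbhd.
  + by apply: open_vertex_nbhd; lra.
  + by split => //; lra.
  + by case=> [|e' y|] //= [_ ym] [[_ ?]|[_ ?]]; lra.
- have y01 := valP y; rewrite /= in y01.
  have [ee'|ee'] := pselect (e' = e); last first.
    exists (inner_nbhd e 0 1), (inner_nbhd e' 0 1).
    split => //; try exact: open_inner_nbhd.
    by case=> [|e'' z|] //= [-> _] [/esym].
  have nxy : sval x != sval y.
    apply/eqP => sxy; apply: xy; rewrite ee'; congr InnerPt; exact: val_inj.
  pose m := (sval x + sval y) / 2.
  have [xy'|yx'|/eqP] := ltgtP (sval x) (sval y); last by rewrite (negbTE nxy).
    exists (inner_nbhd e 0 m), (inner_nbhd e' m 1).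
    split => //; try exact: open_inner_nbhd.
    + by split => //; rewrite /m; lra.
    + by split => //; rewrite /m; lra.
    + by case=> [|e'' z|] //= [_ ?] [_]; lra.
  exists (inner_nbhd e m 1), (inner_nbhd e' 0 m).
  split => //; try exact: open_inner_nbhd.
  + by split => //; rewrite /m; lra.
  + by split => //; rewrite /m; lra.
  + by case=> [|e'' z|] //= [_ ?] [_]; lra.
(* Deleting both endvertices of [e] keeps all inner points of [e] out of the resulting neighbourhood
   of [w]. *)
have fS : finite_set [set etail e; ehead e] by exact: finite_set2.
have [C cC wC] := end_component w fS.
exists (inner_nbhd e 0 1), (end_nbhd [set etail e; ehead e] C 2^-1).
split => //; first exact: open_inner_nbhd.
  by apply: open_end_nbhd wC _ => //; lra.
have nCt : ~ C (etail e) by move=> /(component_notin cC); apply; left.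
have nCh : ~ C (ehead e) by move=> /(component_notin cC); apply; right.
by case=> [|e' z|] //= [-> _] [[]|[]|[]].
Qed.

Lemma freudenthal_hausdorff : hausdorff_space (freudenthal R G).
Proof.
suff H p q : p <> q -> exists U V : set (freudenthal R G),
    [/\ open U, open V, U p, V q & forall r, U r -> ~ V r].
  rewrite open_hausdorff => p q /eqP /H[U [V [oU oV Up Vq UV]]].
  exists (U, V); first by split; exact/mem_set.
  by split => //; apply/eqP/seteqP; split => // r [/UV].
move=> pq.
have [/not_edges_interior vp|/contrapT[e _ [x px]]] :=
  pselect (~ edges_interior p).
  have [/not_edges_interior vq|/contrapT[e _ [x qx]]] :=
    pselect (~ edges_interior q).
    have [U [V [oU oV Up Vq [UV _]]]] := vertex_or_end_clopen vp vq pq.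
    by exists U, V.
  rewrite qx in pq *.
  have [U [V [oU oV Up Vq UV]]] := inner_point_separated (nesym pq).
  by exists V, U; split => // r Vr /UV.
by rewrite px in pq *; exact: inner_point_separated.
Qed.

End space.

(** * Directed arcs in directed walks *)

(* Any witness tau of the arc factors as f \o phi, and phi is monotone because
   the inner points, which are dense, are traversed in the prescribed order. *)
Lemma arc_witness_ends (R : realType) (G : digraph)
    (f tau : R -> freudenthal R G) A ltA :
  homeo01 f A ->
  (forall u v : R, 0 <= u -> u < v -> v <= 1 ->
    exists2 w : R, u < w < v & edges_interior (f w)) ->
  witness A ltA f -> witness A ltA tau -> tau 0 = f 0 /\ tau 1 = f 1.
Proof.
move=> [cf fA [g cg gf]] dense [_ _ _ ordf] [ct tA _ ordt].
have Iin (x : R) : (`[0, 1]%classic : set R) x <-> 0 <= x <= 1.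
  by rewrite /= in_itv.
pose phi x := g (tau x).
have tauA (x : R) : 0 <= x <= 1 -> exists2 u : R, 0 <= u <= 1 & f u = tau x.
  move=> /Iin x01; have : A (tau x) by rewrite -tA; exists x.
  by rewrite -fA => -[u /Iin u01 fu]; exists u.
have fphi (x : R) : 0 <= x <= 1 -> 0 <= phi x <= 1 /\ f (phi x) = tau x.
  by move=> /tauA[u u01 fu]; rewrite /phi -fu gf //; exact/Iin.
have cphi : {within `[0, 1], continuous phi}.
  apply/continuous_closedP => B cB; apply/closed_subspaceP.
  move/continuous_closedP/(_ B cB)/closed_subspaceP : cg => [V cV VA].
  move/continuous_closedP/(_ V cV)/closed_subspaceP : ct => [V' cV' VA'].
  exists V' => //; rewrite VA'; apply/seteqP; split => x [Vx Ix]; split => //.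
    have : (V `&` A) (tau x) by split => //; rewrite -tA; exists x.
    by rewrite VA => -[].
  have : (g @^-1` B `&` A) (tau x) by split => //; rewrite -tA; exists x.
  by rewrite -VA => -[].
(* If [phi] dropped from [a] to [b], it would pass two parameters [w1 < w2] of inner points in the
   reverse order, so [tau] and [f] would disagree on [ltA]. *)
have mono (a b : R) : 0 <= a -> a < b -> b <= 1 -> phi a <= phi b.
  move=> a0 ab b1; rewrite leNgt; apply/negP => ba.
  have pa : 0 <= phi a <= 1 by apply: (fphi a _).1; lra.
  have pb : 0 <= phi b <= 1 by apply: (fphi b _).1; lra.
  have [w1 w1ab Dw1] : exists2 w : R, phi b < w < phi a & edges_interior (f w).
    by apply: dense; lra.
  have [w2 w2ab Dw2] : exists2 w : R, w1 < w < phi a & edges_interior (f w).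
    by apply: dense; lra.
  have [z zab phz] : exists2 z, z \in `[a, b] & phi z = w2.
    apply: IVT; first lra.
      by apply: continuous_subspaceW cphi => x; rewrite /= !in_itv /=; lra.
    by rewrite minEle maxEle; case: ifP; lra.
  have {}zab : a <= z <= b by move: zab; rewrite in_itv.
  have [y zyb phy] : exists2 y, y \in `[z, b] & phi y = w1.
    apply: IVT; first lra.
      by apply: continuous_subspaceW cphi => x; rewrite /= !in_itv /=; lra.
    by rewrite minEle maxEle phz; case: ifP; lra.
  have {}zyb : z <= y <= b by move: zyb; rewrite in_itv.
  have zy : z != y by apply/eqP => zy; move: phy; rewrite -zy phz; lra.
  have {zy} zy : z < y by rewrite lt_neqAle zy; case/andP: zyb.
  have [|_ fz] := fphi z; first lra.
  have [|_ fy] := fphi y; first lra.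
  rewrite phz in fz; rewrite phy in fy.
  have Iz : (`[0, 1]%classic : set R) z by apply/Iin; lra.
  have Iy : (`[0, 1]%classic : set R) y by apply/Iin; lra.
  have Iw1 : (`[0, 1]%classic : set R) w1 by apply/Iin; lra.
  have Iw2 : (`[0, 1]%classic : set R) w2 by apply/Iin; lra.
  have := ordt z y Iz Iy; rewrite -fz -fy => /(_ Dw2 Dw1)[_ /(_ zy)].
  by move/(ordf _ _ Iw2 Iw1 Dw2 Dw1); lra.
have phisurj (u : R) : 0 <= u <= 1 -> exists2 x : R, 0 <= x <= 1 & phi x = u.
  move=> /Iin u01; have : A (f u) by rewrite -fA; exists u.
  by rewrite -tA => -[x /Iin x01 tx]; exists x => //; rewrite /phi tx gf.
have [|p0 f0] := fphi 0; first lra.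
have [|p1 f1] := fphi 1; first lra.
have [|x x01 px] := phisurj 0; first lra.
have [|y y01 py] := phisurj 1; first lra.
(* [phi] attains 0 at [x] and 1 at [y], so monotonicity forces [phi 0 = 0] and [phi 1 = 1]. *)
rewrite -f0 -f1; split; congr f.
  have [x0|x0] := eqVneq x 0; first by rewrite -[in LHS]x0.
  have := mono 0 x (lexx 0); rewrite lt_neqAle eq_sym x0 px.
  by case/andP: x01 => -> -> /(_ isT isT); lra.
have [y1|y1] := eqVneq y 1; first by rewrite -[in LHS]y1.
have := mono y 1; rewrite lt_neqAle y1 py.
by case/andP: y01 => -> -> /(_ isT isT (lexx 1)); lra.
Qed.

Theorem corollary3p3 (R : realType) (G : digraph)
    (G_locally_finite : locally_finite G)
    (G_connected : weakly_connected G)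
    (s t : freudenthal R G)
    (s_vertex_or_end : vertex_or_end s)
    (t_vertex_or_end : vertex_or_end t)
    (s_neq_t : s <> t)
    (W : set (freudenthal R G))
    (ltW : freudenthal R G -> freudenthal R G -> Prop)
    (W_walk : directed_topological_walk s t W ltW) :
  exists A : set (freudenthal R G), directed_arc s t A /\ A `<=` W.
Proof.
have [[[irr trans total] [sigma wit]] dir /(_ _ wit)[sigma0 sigma1]] := W_walk.
have [cs sW inj ord] := wit.
have Iin (x : R) : (`[0, 1]%classic : set R) x <-> 0 <= x <= 1.
  by rewrite /= in_itv.
have injD (x y : R) : 0 <= x <= 1 -> 0 <= y <= 1 ->
    edges_interior (sigma x) -> sigma x = sigma y -> x = y.
  move=> /Iin x01 /Iin y01 Dx sxy.
  have [|z [_ zuniq]] := inj (sigma x).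
    by split => //; rewrite -sW; exists x.
  by rewrite -(zuniq x) // -(zuniq y).
have [||||f [A [[homeo AW] f0 f1 ordf dense]]] :=
  arc_in_path (@freudenthal_hausdorff R G) cs (@open_edges_interior R G)
    _ _ injD.
- by rewrite sigma0; move: s_vertex_or_end => /not_edges_interior.
- by rewrite sigma1; move: t_vertex_or_end => /not_edges_interior.
- move=> p q /not_edges_interior vp /not_edges_interior vq pq.
  have [U [V [oU oV Up Vq [UV cov]]]] := vertex_or_end_clopen vp vq pq.
  by exists U, V; split => //; split => // r /not_edges_interior /cov.
- by rewrite sigma0 sigma1.
rewrite sW in AW; rewrite sigma0 in f0; rewrite sigma1 in f1.
have [cf fA [g cg gf]] := homeo.
(* Since [f] meets its inner points in the order of [sigma], the order [ltW] serves for [A]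
   unchanged. *)
have witf : witness A ltW f.
  split => //.
    move=> p [Dp]; rewrite -fA => -[u u01 fu]; exists u; split => //.
    by move=> v [v01 fv]; rewrite -(gf u) // -(gf v) // fu fv.
  move=> u v /Iin u01 /Iin v01 Du Dv.
  have [x [y [x01 y01 fx fy <-]]] := ordf u v u01 v01 Du Dv.
  rewrite fx fy in Du Dv *.
  by apply: ord => //; exact/Iin.
exists A; split => //; split; first by exists f.
exists ltW; split.
- split; last by exists f.
  split.
  + by move=> p [Dp /AW Wp]; exact: irr.
  + by move=> p q r [Dp /AW Wp] [Dq /AW Wq] [Dr /AW Wr]; exact: trans.
  + by move=> p q [Dp /AW Wp] [Dq /AW Wq]; exact: total.
- move=> e [p0 [ep0 /AW Wp0]] p q [ep /AW Wp] [eq /AW Wq].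
  by apply: dir => //; exists p0.
(* Every witness of the arc, not just [f], has to run from [s] to [t]. *)
move=> tau wtau; rewrite -f0 -f1.
exact: arc_witness_ends homeo dense witf wtau.
Qed.
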